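(* Let $I\subset\mathbf k[\mathbf x]$ be a monomial ideal with cofinite support and $x_i\notin I$ for all $i$. Let $\gamma\in\mathbb Z^n_{\ge0}\setminus\operatorname{supp}(I)$ be an inner root which is not of the form $\ell e_i$ for any $i$ and any integer $\ell$. Then for every $r\in N_{\mathbf k}$ there exist $p,q\in N_{\mathbf k}$ and inner roots $\alpha,\beta$ with $\alpha+\beta=\gamma$ such that $[\overline\partial_{\alpha,p},\overline\partial_{\beta,q}]=\overline\partial_{\gamma,r}$. In particular, any such root $\gamma$ is reducible.
   Context: Setting: $\mathbf k$ is an algebraically closed field of characteristic zero, $n\ge1$, $M=\mathbb Z^n$ with canonical basis $E=\{e_1,\dots,e_n\}$, and $N_{\mathbf k}=\operatorname{Hom}(M,\mathbf k)\cong\mathbf k^n$ with dual basis $e_1^*,\dots,e_n^*$. $\mathbf k[\mathbf x]=\mathbf k[x_1,\dots,x_n]$ and $\mathbf x^m=x_1^{m_1}\cdots x_n^{m_n}$. For a monomial ideal $I$, $\operatorname{supp}(I)=\{m\in\mathbb Z^n_{\ge0}:\mathbf x^m\in I\}$; $I$ has cofinite support if $\mathbb Z^n_{\ge0}\setminus\operatorname{supp}(I)$ is finite. Set $A=\mathbf k[\mathbf x]/I$. For $\alpha\in\mathbb Z^n$ and $p\in N_{\mathbf k}$, $\partial_{\alpha,p}$ denotes the homogeneous derivation $\mathbf x^m\mapsto p(m)\mathbf x^{m+\alpha}$ of $\mathbf k[\mathbf x]$ (whenever it maps $\mathbf k[\mathbf x]$ to itself), and $\overline\partial_{\alpha,p}$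 the derivation induced on $A$ when $\partial_{\alpha,p}(I)\subseteq I$ (automatic for $\alpha\in\mathbb Z^n_{\ge0}$). A root is a degree $\alpha\in\mathbb Z^n\setminus\{0\}$ for which there is a nonzero homogeneous derivation of $A$ of degree $\alpha$; $\mathcal R(I)$ is the set of roots; a root is inner if it lies in $\mathbb Z^n_{\ge0}$ and outer otherwise. An inner degree $\alpha\neq0$ is a root iff there is $i$ with $\alpha+e_i\notin\operatorname{supp}(I)$. $\mathfrak g_\alpha\subset\operatorname{Der}_{\mathbf k}(A)$ is the space of homogeneous derivations of degree $\alpha$ (for $\alpha$ inner, $\mathfrak g_\alpha=\{\overline\partial_{\alpha,p}:p\in N_{\mathbf k}\}$). For a root $\gamma$, $B_\gamma=\sum[\mathfrak g_\alpha,\mathfrak g_\beta]$, sum over $\alpha,\beta\in\mathcal R(I)$ with $\alpha+\beta=\gamma$; $\gamma$ is reducible if $B_\gamma=\mathfrak g_\gamma$. *)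

(* Defs.v *)
From HB Require Import structures.
From mathcomp Require Import all_boot all_order all_algebra.
From mathcomp Require Import mpoly.

Set Implicit Arguments.
Unset Strict Implicit.
Unset Printing Implicit Defensive.

Import GRing.Theory.
Local Open Scope ring_scope.
Local Open Scope quotient_scope.

Section Lattice.
Variable n : nat.

Definition stdvec (i : 'I_n) : 'rV[int]_n := delta_mx 0 i.

Definition nonneg (m : 'rV[int]_n) : bool := [forall i, 0 <= m 0 i].

Definition exponent (m : 'X_{1..n}) : 'rV[int]_n := \row_i (m i)%:Z.

(* The monomial x^m for m in Z^n; it is 0 when m has a negative coordinate,
   so that for every m the line k x^m is the degree m component of k[x]. *)
Definition xmon (k : nzRingType) (m : 'rV[int]_n) : {mpoly k[n]} :=
  if nonneg m then 'X_[ [multinom absz (m 0%R i) | i < n] ] else 0.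

End Lattice.

Section MonomialIdeals.
Variables (k : nzRingType) (n : nat).
Implicit Type I : {pred {mpoly k[n]}}.

Definition monomial_ideal I : Prop :=
  exists S : 'X_{1..n} -> Prop, forall f,
    f \in I <->
    exists N (h : 'I_N -> {mpoly k[n]}) (m : 'I_N -> 'X_{1..n}),
      (forall j, S (m j)) /\ f = \sum_j h j * 'X_[m j].

Definition supp I (m : 'rV[int]_n) : bool := nonneg m && (xmon k m \in I).

Definition cofinite_support I : Prop :=
  exists s : seq 'rV[int]_n, forall m, nonneg m -> ~~ supp I m -> m \in s.

End MonomialIdeals.

(* k[x]/I with its k-algebra structure; the structure idealr of ideals
   includes 1 \notin I. *)
Section QuotientAlgebra.
Variables (k : fieldType) (n : nat) (I : idealr {mpoly k[n]}).

Definition qalg : Type := {ideal_quot I}.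

HB.instance Definition _ := GRing.ComNzRing.on qalg.
HB.instance Definition _ := EqQuotient.on qalg.

Definition qproj (f : {mpoly k[n]}) : qalg := \pi_{ideal_quot I} f.

Definition qscale (c : k) (a : qalg) : qalg := qproj c%:MP * a.

Lemma qprojD f g : qproj (f + g) = qproj f + qproj g.
Proof. exact: (raddfD (\pi_{ideal_quot I})). Qed.

Lemma qprojM f g : qproj (f * g) = qproj f * qproj g.
Proof. exact: (rmorphM (\pi_{ideal_quot I})). Qed.

Lemma qproj1 : qproj 1 = 1.
Proof. exact: (rmorph1 (\pi_{ideal_quot I})). Qed.

Lemma qscaleA b c a : qscale b (qscale c a) = qscale (b * c) a.
Proof. by rewrite /qscale mpolyCM qprojM mulrA. Qed.

Lemma qscale1 : left_id 1 qscale.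
Proof. by move=> a; rewrite /qscale mpolyC1 qproj1 mul1r. Qed.

Lemma qscaleDr : right_distributive qscale +%R.
Proof. by move=> c a b; rewrite /qscale mulrDr. Qed.

Lemma qscaleDl a : {morph qscale^~ a : b c / b + c}.
Proof. by move=> b c; rewrite /qscale mpolyCD qprojD mulrDl. Qed.

HB.instance Definition _ :=
  GRing.Zmodule_isLmodule.Build k qalg qscaleA qscale1 qscaleDr qscaleDl.

Lemma qscaleAl (c : k) (a b : qalg) : c *: (a * b) = (c *: a) * b.
Proof. exact: mulrA. Qed.

HB.instance Definition _ := GRing.Lmodule_isLalgebra.Build k qalg qscaleAl.

End QuotientAlgebra.

Section Derivations.
Variables (k : fieldType) (n : nat) (I : idealr {mpoly k[n]}).
Local Notation A := (qalg I).
Local Notation M := 'rV[int]_n.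

Definition derivation (D : A -> A) : Prop :=
  linear D /\ forall a b, D (a * b) = D a * b + a * D b.

Definition bracket (D1 D2 : A -> A) : A -> A :=
  fun a => D1 (D2 a) - D2 (D1 a).

(* The degree m component of A. *)
Definition hcomp (m : M) (a : A) : Prop :=
  exists c : k, a = c *: qproj I (xmon k m).

(* The space g_alpha of homogeneous derivations of degree alpha. *)
Definition homder (alpha : M) (D : A -> A) : Prop :=
  derivation D /\ forall m a, hcomp m a -> hcomp (m + alpha) (D a).

Definition is_root (alpha : M) : Prop :=
  alpha <> 0 /\ exists2 D, homder alpha D & exists a, D a <> 0.

Definition inner_root (alpha : M) : Prop := is_root alpha /\ nonneg alpha.

(* The space B_gamma; a sum of spaces [g_alpha, g_beta] being spanned by the
   brackets of elements of g_alpha and g_beta. *)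
Definition bracket_span (gamma : M) (D : A -> A) : Prop :=
  exists N (c : 'I_N -> k) (alpha beta : 'I_N -> M) (D1 D2 : 'I_N -> A -> A),
    (forall j, [/\ is_root (alpha j), is_root (beta j),
                   alpha j + beta j = gamma,
                   homder (alpha j) (D1 j) & homder (beta j) (D2 j)])
    /\ forall a, D a = \sum_j c j *: bracket (D1 j) (D2 j) a.

Definition reducible (gamma : M) : Prop :=
  forall D, bracket_span gamma D <-> homder gamma D.

(* The linear map x^m |-> p(m) x^(m + alpha). It is the derivation
   partial_{alpha,p} as soon as p(m) = 0 for every m >= 0 such that m + alpha
   has a negative coordinate, in particular for every alpha >= 0. *)
Definition pder (alpha : M) (p : {additive M -> k}) (f : {mpoly k[n]}) :
    {mpoly k[n]} :=
  \sum_(m <- msupp f) (f@_m * p (exponent m)) *: xmon k (exponent m + alpha).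

(* The map induced by [pder alpha p] on A; it does not depend on the choice of
   representatives when [pder alpha p] maps I to itself, in particular when I
   is a monomial ideal and alpha >= 0. *)
Definition qder (alpha : M) (p : {additive M -> k}) (a : A) : A :=
  qproj I (pder alpha p (repr a)).

End Derivations.

Arguments qder {k n} I alpha p a.

(* Main.v *)
Require Import Defs.
From HB Require Import structures.
From mathcomp Require Import all_boot all_order all_algebra.
From mathcomp Require Import mpoly.

Set Implicit Arguments.
Unset Strict Implicit.
Unset Printing Implicit Defensive.

Import GRing.Theory.
Local Open Scope ring_scope.

(** Inner derivations multiply by the rule
      [d_(a,p), d_(b,q)] = d_(a+b, p(b) q - q(a) p),
    so for a splitting gamma = a + b one has to solve p(b) q - q(a) p = r for
    p and q. If p can be chosen with p(a) = 0 and p(b) = 1, then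
    q = r + r(a) p is a solution, because q(a) = r(a). Such a p exists as soon
    as some coordinate vanishes on a but not on b.

    Since gamma is on no coordinate axis, it has two nonzero coordinates
    i <> j, and the splitting a = e_i, b = gamma - e_i will do, with p the j-th
    coordinate divided by gamma_j (invertible in characteristic 0). Both parts
    are roots: d_(b,s) sends x_i to a multiple of x^gamma, which is nonzero in
    the quotient, and d_(a,s) sends x_j to a multiple of x_i x_j, which divides
    x^gamma. This is [qder_is_bracket].

    Reducibility follows because every homogeneous derivation D of degree gamma
    is some d_(gamma,r) ([homder_inner_qder]): D is determined by its values on
    the variables, D x_i = c_i x^(gamma + e_i), and r is the linear form with
    r(e_i) = c_i. So D is a single bracket. Conversely brackets of homogeneous
    derivations are homogeneous derivations of the sum of the degrees.

    The structure of derivation of d_(a,p) comes from the identity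
      d_(a,p) = x^a \sum_i p(e_i) x_i d/dx_i
    on polynomials ([pderE]). *)

(** * Exponent vectors *)

Section Exponents.
Variable n : nat.
Implicit Types (a b m : 'X_{1..n}) (i j : 'I_n).

Lemma exponentD a b : exponent (a + b)%MM = exponent a + exponent b.
Proof. by apply/rowP=> i; rewrite !mxE mnmDE PoszD. Qed.

Lemma exponentU i : exponent U_(i)%MM = stdvec i.
Proof. by apply/rowP=> j; rewrite !mxE mnmE eqxx /= eq_sym; case: eqP. Qed.

Lemma exponent_inj : injective (@exponent n).
Proof.
move=> a b eq_ab; apply/mnmP=> i.
by move/rowP/(_ i): eq_ab; rewrite !mxE => -[].
Qed.

Lemma exponent0 : exponent (0%MM : 'X_{1..n}) = 0.
Proof. by apply/rowP=> i; rewrite !mxE mnm0E. Qed.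

Lemma nonneg_exponent a : nonneg (exponent a).
Proof. by apply/forallP=> i; rewrite mxE. Qed.

Lemma nonnegP (v : 'rV[int]_n) : reflect (exists a, v = exponent a) (nonneg v).
Proof.
apply: (iffP forallP) => [v_ge0 | [a ->] i]; last by rewrite mxE.
exists [multinom absz (v 0%R i) | i < n]; apply/rowP=> i.
by rewrite mxE mnmE gez0_abs.
Qed.

Lemma xmon_exponent (k : nzRingType) a : xmon k (exponent a) = 'X_[a].
Proof.
rewrite /xmon nonneg_exponent; congr 'X_[_].
by apply/mnmP=> i; rewrite mnmE mxE.
Qed.

Lemma exponent_sum a : exponent a = \sum_i stdvec i *+ a i.
Proof.
rewrite [LHS]row_sum_delta; apply: eq_bigr => i _.
by rewrite mxE -natz scaler_nat.
Qed.

(** The multiple l = 0 of any standard vector is excluded, so a has a nonzero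
    coordinate i; were it the only one, a would be a multiple of e_i. When
    n = 0 there is no standard vector and the hypothesis is void. *)
Lemma off_axis_coords (n_gt0 : (0 < n)%N) a :
    (forall i (l : int), exponent a <> stdvec i *~ l) ->
  exists i j, [/\ i != j, a i != 0%N & a j != 0%N].
Proof.
move=> aNaxis; have [i ai] : exists i, a i != 0%N.
  apply/existsP; apply: contraT; rewrite negb_exists => /forallP a0.
  case: (aNaxis (Ordinal n_gt0) 0); rewrite mulr0z -exponent0; congr exponent.
  by apply/mnmP=> i; rewrite mnm0E; apply/eqP/negbNE.
have [j /andP[ij aj]] : exists j, (i != j) && (a j != 0%N).
  apply/existsP; apply: contraT; rewrite negb_exists => /forallP a0.
  case: (aNaxis i (a i)); apply/rowP=> j; rewrite -pmulrn mulmxnE !mxE /=.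
  case: (eqVneq j i) => [->|ji].
    by rewrite mulr1n natz.
  have := a0 j; rewrite eq_sym ji /= negbK => /eqP->.
  by rewrite mul0rn.
by exists i, j.
Qed.

End Exponents.

(** * Linear forms on the lattice *)

Section LinearForms.
Variables (k : fieldType) (n : nat).

Definition linform (c : 'I_n -> k) (v : 'rV[int]_n) : k :=
  \sum_i (v 0 i)%:~R * c i.

Lemma linform_zmod_morphism c : zmod_morphism (linform c).
Proof.
move=> u v; rewrite /linform -sumrB; apply: eq_bigr => i _.
by rewrite !mxE rmorphB /= mulrBl.
Qed.

HB.instance Definition _ c :=
  GRing.isZmodMorphism.Build 'rV[int]_n k (linform c) (linform_zmod_morphism c).

Lemma linform_stdvec c i : linform c (stdvec i) = c i.
Proof.
rewrite /linform (bigD1 i) //= big1 => [|j /negPf ji]; rewrite mxE eqxx.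
  by rewrite eqxx mul1r addr0.
by rewrite ji mul0r.
Qed.

End LinearForms.

(** * Homogeneous derivations of the polynomial ring *)

Section PolynomialDerivations.
Variables (k : fieldType) (n : nat).
Implicit Types (a m : 'X_{1..n}) (p : {additive 'rV[int]_n -> k}).

(** Monomials are eigenvectors of every Euler operator: x_i d/dx_i multiplies
    x^m by m_i, and the p-weighted sum of the m_i is p(m). *)
Lemma euler_monomial p m :
  \sum_i p (stdvec i) *: ('X_i * ('X_[m])^`M(i)) =
    p (exponent m) *: 'X_[m] :> {mpoly k[n]}.
Proof.
rewrite exponent_sum raddf_sum scaler_suml; apply: eq_bigr => i _ /=.
rewrite mderivX -scalerAr -mpolyXD scalerA raddfMn mulr_natr.
case: (posnP (m i)) => [-> | mi_gt0]; first by rewrite !scale0r.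
by rewrite addmC submK // lep1mP -lt0n.
Qed.

(** Both sides are linear in f and agree on monomials. The right-hand side is a
    combination of partial derivatives, so linearity and the Leibniz rule are
    inherited from them. *)
Lemma pderE a p f :
  pder (exponent a) p f =
    'X_[a] * \sum_i p (stdvec i) *: ('X_i * f^`M(i)) :> {mpoly k[n]}.
Proof.
rewrite /pder [f in RHS]mpolyE.
transitivity ('X_[a] * \sum_(m <- msupp f)
    f@_m *: \sum_i p (stdvec i) *: ('X_i * ('X_[m])^`M(i))).
  rewrite mulr_sumr; apply: eq_bigr => m _.
  rewrite euler_monomial scalerA -scalerAr -exponentD xmon_exponent.
  by rewrite [(m + a)%MM]addmC mpolyXD.
congr (_ * _); under eq_bigr => m _ do rewrite scaler_sumr.
rewrite exchange_big; apply: eq_bigr => i _ /=.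
rewrite raddf_sum mulr_sumr scaler_sumr; apply: eq_bigr => m _ /=.
by rewrite mderivZ -scalerAr scalerA scalerA mulrC.
Qed.

Lemma pderX a p m :
  pder (exponent a) p 'X_[m] = p (exponent m) *: 'X_[m + a].
Proof. by rewrite pderE euler_monomial -scalerAr -mpolyXD addmC. Qed.

Lemma pder_linear a p : linear (pder (exponent a) p : {mpoly k[n]} -> _).
Proof.
move=> c f g; rewrite !pderE scalerAr -mulrDr; congr (_ * _).
rewrite scaler_sumr -big_split; apply: eq_bigr => i _ /=.
by rewrite mderivD mderivZ mulrDr scalerDr -scalerAr !scalerA [_ * c]mulrC.
Qed.

HB.instance Definition _ a p := GRing.isLinear.Build k {mpoly k[n]} {mpoly k[n]}
  _ (pder (exponent a) p) (pder_linear a p).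

Lemma pderM a p (f g : {mpoly k[n]}) :
  pder (exponent a) p (f * g) =
    pder (exponent a) p f * g + f * pder (exponent a) p g.
Proof.
rewrite !pderE -mulrA [f * ('X_[a] * _)]mulrCA -mulrDr; congr (_ * _).
rewrite mulr_suml mulr_sumr -big_split; apply: eq_bigr => i _ /=.
rewrite mderivM mulrDr scalerDr -scalerAl -scalerAr ['X_i * (_ * g)]mulrA.
by rewrite [f * ('X_i * _)]mulrCA.
Qed.

(** By the Leibniz rule it suffices that the monomials generating I are sent
    into I; they are sent to multiples of themselves. *)
Lemma pder_ideal (I : idealr {mpoly k[n]}) (monI : monomial_ideal I) a p f :
  f \in I -> pder (exponent a) p f \in I.
Proof.
case: monI => S IS fI; case/IS: (fI) => N [h [m [Sm ->]]].
have mI j : 'X_[m j] \in I.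
  apply/IS; exists 1, (fun=> 1), (fun=> m j); split=> //.
  by rewrite big_ord1 mul1r.
rewrite raddf_sum rpred_sum // => j _ /=.
by rewrite pderM pderX addmC mpolyXD scalerAl rpredD ?idealMr.
Qed.

End PolynomialDerivations.

(** * Derivations of the quotient *)

Section QuotientDerivations.
Variables (k : fieldType) (n : nat) (I : idealr {mpoly k[n]}).
Implicit Types (a b m : 'X_{1..n}) (p q r : {additive 'rV[int]_n -> k}).
Local Notation A := (qalg I).
Local Notation pi := (qproj I).

Lemma qprojZ c f : pi (c *: f) = c *: pi f.
Proof. by rewrite -mul_mpolyC qprojM. Qed.

Lemma qscaleAr c (x y : A) : c *: (x * y) = x * (c *: y).
Proof. by rewrite mulrC scalerAl mulrC. Qed.

HB.instance Definition _ := GRing.isLinear.Build k {mpoly k[n]} A _ pi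
  (fun c f g => etrans (qprojD I (c *: f) g)
                       (congr1 (+%R^~ (pi g)) (qprojZ c f))).

Lemma qproj_eq0 f : (pi f == 0) = (f \in I).
Proof.
by rewrite -[f in RHS]subr0 Quotient.idealrBE -(linear0 pi).
Qed.

Lemma qproj_repr (x : A) : pi (repr x) = x.
Proof. exact: reprK. Qed.

(** Gives access to the theory of bundled linear maps from the bare linearity
    predicate occurring in [derivation]. *)
Lemma linear_bundle (F : A -> A) : linear F ->
  exists L : {linear A -> A}, F = L.
Proof.
move=> linF; pose mixF := GRing.isLinear.Build k A A _ F linF.
by exists (HB.pack_for {linear A -> A} F mixF).
Qed.

(** The classes of the monomials span A. *)
Lemma qalg_linear_eq (F G : A -> A) : linear F -> linear G ->
  (forall m, F (pi 'X_[m]) = G (pi 'X_[m])) -> F =1 G.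
Proof.
move=> /linear_bundle[{}F ->] /linear_bundle[{}G ->] eqFG x.
rewrite -(qproj_repr x) [repr x]mpolyE !linear_sum; apply: eq_bigr => m _ /=.
by rewrite !linearZ /= eqFG.
Qed.

Lemma derivation1 (D : A -> A) : derivation D -> D 1 = 0.
Proof.
case=> _ DM; have := DM 1 1; rewrite !mulr1 mul1r => D1.
by apply: (addrI (D 1)); rewrite addr0 -D1.
Qed.

(** The classes of the variables generate the algebra A. *)
Lemma derivation_eq (D E : A -> A) : derivation D -> derivation E ->
  (forall i, D (pi 'X_i) = E (pi 'X_i)) -> D =1 E.
Proof.
move=> derD derE eqDE; have [linD DM] := derD; have [linE EM] := derE.
apply: qalg_linear_eq => // m; rewrite mpolyXE_id.
pose P f := D (pi f) = E (pi f).
have P1 : P 1 by rewrite /P qproj1 !derivation1.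
have PM f g : P f -> P g -> P (f * g).
  by rewrite /P qprojM DM EM => -> ->.
apply: (big_ind P) => // i _.
by elim: (m i) => [|l IHl]; rewrite ?expr0 ?exprS //; apply: PM.
Qed.

Lemma bracket_derivation (D E : A -> A) : derivation D -> derivation E ->
  derivation (bracket D E).
Proof.
move=> [/linear_bundle[{}D ->] DM] [/linear_bundle[{}E ->] EM].
split=> [c|] x y; rewrite /bracket.
  by rewrite !linearP addrACA scalerDr.
rewrite EM DM (linearD D) (linearD E) !DM !EM mulrBl mulrBr.
(* The mixed terms t and u occur with both signs and cancel. *)
set p := D (E x) * y; set q := E (D x) * y.
set r := x * D (E y); set s := x * E (D y).
set t := E x * D y; set u := D x * E y.
rewrite [u + r]addrC [t + s]addrC (addrACA p) (addrACA q) [u + t]addrC.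
by rewrite opprD (addrACA (p + r)) subrr addr0 opprD addrACA.
Qed.

Lemma hcompP m x : hcomp (exponent m) x <-> exists c, x = c *: pi 'X_[m].
Proof. by rewrite /hcomp xmon_exponent. Qed.

Lemma hcompD v (x y : A) : hcomp v x -> hcomp v y -> hcomp v (x + y).
Proof. by case=> c -> [d ->]; exists (c + d); rewrite scalerDl. Qed.

Lemma hcompZ v c (x : A) : hcomp v x -> hcomp v (c *: x).
Proof. by case=> d ->; exists (c * d); rewrite scalerA. Qed.

Lemma hcomp0 v : hcomp v (0 : A).
Proof. by exists 0; rewrite scale0r. Qed.

Hypothesis monI : monomial_ideal I.

(** As d_(a,p) preserves I, the representative used to define the induced map
    does not matter. *)
Lemma qder_qproj a p f :
  qder I (exponent a) p (pi f) = pi (pder (exponent a) p f).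
Proof.
apply/eqP; rewrite /qder -subr_eq0 -linearB /= qproj_eq0 -raddfB.
by apply: pder_ideal => //; rewrite -qproj_eq0 linearB /= qproj_repr subrr.
Qed.

Lemma qderX a p m :
  qder I (exponent a) p (pi 'X_[m]) = p (exponent m) *: pi 'X_[m + a].
Proof. by rewrite qder_qproj pderX qprojZ. Qed.

Lemma qder_derivation a p : derivation (qder I (exponent a) p).
Proof.
split=> [c x y|x y]; rewrite -(qproj_repr x) -(qproj_repr y).
  by rewrite -linearZ -linearD !qder_qproj linearP !linearP.
by rewrite -qprojM !qder_qproj pderM qprojD !qprojM.
Qed.

Lemma qder_homder a p : homder (exponent a) (qder I (exponent a) p).
Proof.
split=> [|v _ [c ->]]; first exact: qder_derivation.
have [/linear_bundle[d dE] _] := qder_derivation a p; rewrite dE linearZ -dE.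
apply: hcompZ; case: (boolP (nonneg v)) => [/nonnegP[m ->] | /negPf v_neg].
  rewrite xmon_exponent qderX -exponentD; apply/hcompP.
  by exists (p (exponent m)).
by rewrite /xmon v_neg dE !linear0; apply: hcomp0.
Qed.

(** The witness is the derivation of degree a for the form with value 1 at each
    e_i: it sends x_i to x^(a + e_i). *)
Lemma inner_root_exponent a i : a != 0%MM -> 'X_[a + U_(i)] \notin I ->
  inner_root I (exponent a).
Proof.
move=> a_neq0 aiNI; split; last exact: nonneg_exponent.
split; first by rewrite -(exponent0 n) => /exponent_inj; apply/eqP.
exists (qder I (exponent a) (linform (fun=> 1))); first exact: qder_homder.
exists (pi 'X_i); apply/eqP.
by rewrite qderX exponentU /= linform_stdvec scale1r addmC qproj_eq0.
Qed.

(** An inner degree a puts no constraint on the form: choosing c_i with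
    D x_i = c_i x^(a + e_i), the form r with r(e_i) = c_i gives a derivation
    that agrees with D on generators. *)
Lemma homder_inner_qder a D : homder (exponent a) D ->
  exists r, D =1 qder I (exponent a) r.
Proof.
case=> derD homD.
have Dx i : exists c, D (pi 'X_i) == c *: pi 'X_[U_(i) + a].
  have /hcompP[c ->] : hcomp (exponent (U_(i) + a)%MM) (D (pi 'X_i)).
    by rewrite exponentD; apply: homD; apply/hcompP; exists 1; rewrite scale1r.
  by exists c.
exists (linform (fun i => xchoose (Dx i))).
apply: derivation_eq => // [|i]; first exact: qder_derivation.
by rewrite qderX exponentU /= linform_stdvec; apply/eqP/(xchooseP (Dx i)).
Qed.

(** On x^m the two composites have coefficients q(m) p(m + b) and p(m) q(m + a),
    whose common part p(m) q(m) cancels. The form is a parameter r known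
    pointwise, so that it need not be the difference literally. *)
Lemma bracket_qder a b p q r :
    (forall v, r v = p (exponent b) * q v - q (exponent a) * p v) ->
  bracket (qder I (exponent a) p) (qder I (exponent b) q) =1
    qder I (exponent (a + b)%MM) r.
Proof.
move=> rE; have [/linear_bundle[d dE] _] := qder_derivation a p.
have [/linear_bundle[e eE] _] := qder_derivation b q.
apply: qalg_linear_eq => [||m].
- by case: (bracket_derivation (qder_derivation a p) (qder_derivation b q)).
- by case: (qder_derivation (a + b)%MM r).
rewrite /bracket !qderX dE eE !linearZ /= -dE -eE !qderX !scalerA -!addmA.
rewrite [(b + a)%MM]addmC scalerN scalerA -scalerBl.
rewrite rE !exponentD !raddfD /= !mulrDr.
rewrite [p (exponent m) * q (exponent m)]mulrC opprD addrACA subrr add0r.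
by rewrite mulrC [p (exponent m) * _]mulrC.
Qed.

End QuotientDerivations.

(** * Splitting an inner root off the axes *)

Section Reducibility.
Variables (k : fieldType) (n : nat) (I : idealr {mpoly k[n]}).
Implicit Types (a b g : 'X_{1..n}) (r : {additive 'rV[int]_n -> k}).

Lemma bracket_homder u v D E : homder u D -> homder v E ->
  homder (u + v) (bracket (I := I) D E).
Proof.
case=> derD homD [derE homE]; split; first exact: bracket_derivation.
move=> m x xm; rewrite /bracket -scaleN1r; apply: hcompD; last apply: hcompZ.
  by rewrite [u + v]addrC addrA; apply/homD/homE.
by rewrite addrA; apply/homE/homD.
Qed.

Lemma bracket_span_homder w D : bracket_span (I := I) w D -> homder w D.
Proof.
case=> N [c [u [v [D1 [D2 [roots DE]]]]]].
have homB j : homder w (bracket (D1 j) (D2 j)).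
  by have [_ _ <-] := roots j; apply: bracket_homder.
split; first split=> [d x y | x y].
- rewrite !DE scaler_sumr -big_split; apply: eq_bigr => j _ /=.
  have [[/linear_bundle[b ->] _] _] := homB j.
  by rewrite linearP scalerDr !scalerA [d * _]mulrC.
- rewrite !DE mulr_suml mulr_sumr -big_split; apply: eq_bigr => j _ /=.
  have [[_ ->] _] := homB j.
  by rewrite scalerDr scalerAl qscaleAr.
move=> m x xm; rewrite DE; apply: big_ind => [|y z|j _].
- exact: hcomp0.
- exact: hcompD.
by apply: hcompZ; have [_ homBj] := homB j; apply: homBj.
Qed.

Lemma ideal_mulX a b : 'X_[a] \in I -> 'X_[a + b] \in I.
Proof. by move=> aI; rewrite addmC mpolyXD idealMr. Qed.

(** Splitting off one unit of the i-th coordinate leaves the j-th coordinate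
    entirely in the second part, which is what makes a form with p(a) = 0 and
    p(b) = 1 available. *)
Lemma qder_is_bracket (monI : monomial_ideal I)
    (char0 : [pchar k] =i pred0) g i j r :
    i != j -> g i != 0%N -> g j != 0%N -> 'X_[g] \notin I ->
  exists a b p q,
    [/\ inner_root I (exponent a), inner_root I (exponent b), (a + b)%MM = g
      & bracket (qder I (exponent a) p) (qder I (exponent b) q) =1
          qder I (exponent g) r].
Proof.
move=> ij gi gj gNI; pose b := (g - U_(i))%MM.
have gE : (U_(i) + b)%MM = g by rewrite addmC submK // lep1mP.
have bj : b j = g j by rewrite mnmBE mnmE (negPf ij) subn0.
have gj_neq0 : (g j)%:R != 0 :> k by have /pcharf0P-> := char0.
(* The j-th coordinate, normalized so that its value at b is 1. *)
pose p : {additive 'rV[int]_n -> k} :=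
  linform (fun l => (l == j)%:R / (g j)%:R).
have pa : p (exponent U_(i)) = 0.
  by rewrite exponentU /p /= linform_stdvec (negPf ij) mul0r.
have pb : p (exponent b) = 1.
  rewrite /p /= /linform (bigD1 j) //= big1 => [|l /negPf->]; rewrite !mxE.
    by rewrite eqxx bj mul1r addr0 divff.
  by rewrite mul0r mulr0.
(* q (e_i) = r (e_i) as p (e_i) = 0, so q - q (e_i) p = r *)
pose q : {additive 'rV[int]_n -> k} := r \+ (r (exponent U_(i)) \*o p).
exists U_(i)%MM, b, p, q; split=> //.
- apply: (@inner_root_exponent _ _ _ monI _ j).
    by apply/eqP=> /mnmP/(_ i); rewrite mnmE eqxx mnm0E.
  apply: contra gNI => ijI; rewrite -gE.
  (* x_i x_j divides x^g *)
  have -> : b = (U_(j) + (b - U_(j)))%MM by rewrite addmC submK // lep1mP bj.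
  by rewrite addmA ideal_mulX.
- apply: (@inner_root_exponent _ _ _ monI _ i); last by rewrite addmC gE.
  by apply: contraNneq gj => b0; rewrite -bj b0 mnm0E.
rewrite -gE; apply: bracket_qder => // v; rewrite /q /= pa pb.
by rewrite mulr0 addr0 mul1r addrK.
Qed.

End Reducibility.

Theorem lemma4p3 (k : closedFieldType) (char0 : [pchar k] =i pred0)
    (n : nat) (n_gt0 : (0 < n)%N) (I : idealr {mpoly k[n]})
    (monI : monomial_ideal I) (cofI : cofinite_support I)
    (XnotinI : forall i : 'I_n, 'X_i \notin I)
    (gamma : 'rV[int]_n)
    (gamma_inner : inner_root I gamma)
    (gammaNsupp : ~~ supp I gamma)
    (gammaNaxis : forall (i : 'I_n) (l : int), gamma <> stdvec i *~ l) :
  (forall r : {additive 'rV[int]_n -> k},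
     exists (p q : {additive 'rV[int]_n -> k}) (alpha beta : 'rV[int]_n),
       [/\ inner_root I alpha, inner_root I beta, alpha + beta = gamma
         & bracket (qder I alpha p) (qder I beta q) =1 qder I gamma r])
  /\ reducible I gamma.
Proof.
have [_ /nonnegP[g gammaE]] := gamma_inner; subst gamma.
have gNI : 'X_[g] \notin I.
  by move: gammaNsupp; rewrite /supp nonneg_exponent xmon_exponent.
have [i [j [ij gi gj]]] := off_axis_coords n_gt0 gammaNaxis.
have surj r := qder_is_bracket monI char0 r ij gi gj gNI.
split=> [r | D].
  have [a [b [p [q [aR bR ab_g br]]]]] := surj r.
  by exists p, q, (exponent a), (exponent b); split; rewrite -?exponentD ?ab_g.
split=> [|homD]; first exact: bracket_span_homder.
have [r Dr] := homder_inner_qder monI homD.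
have [a [b [p [q [[aR _] [bR _] ab_g br]]]]] := surj r.
exists 1, (fun=> 1), (fun=> exponent a), (fun=> exponent b).
exists (fun=> qder I (exponent a) p), (fun=> qder I (exponent b) q).
split=> [_ | x]; last by rewrite big_ord1 scale1r br Dr.
by split; rewrite -?exponentD ?ab_g //; apply: qder_homder.
Qed.
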